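(* Let $A$ be a unital algebra with differential graded algebra $(\Omega,\mathrm d)$ and let $(\nabla,\sigma)$ be a Leibniz compatible bimodule connection on $\Omega^1$, i.e. $\nabla_2\sigma_1=\sigma_2\nabla_2$ on $\Omega^1\otimes_A\Omega^1$. Then $\nabla^n:A\to\Omega^{1\otimes_An}$ obeys the $n$-th order Leibniz rule $$\nabla^n(ab)=\sum_{k=0}^n\left[{n\atop k},\sigma\right]\nabla^{n-k}a\otimes\nabla^kb$$ for all $a,b\in A$ (and all $n\ge0$).
   Context: Everything is over a field. $A$ is a unital algebra and $(\Omega=\oplus_n\Omega^n,\mathrm d)$ is a differential graded algebra with $\Omega^0=A$, graded Leibniz rule and $\Omega$ generated by $A,\mathrm dA$. $\Omega^{1\otimes_An}$ is the $n$-fold tensor power over $A$ (with $\Omega^{1\otimes_A0}=A$). $\sigma_i$ denotes $\sigma$ applied in tensor factors $i,i+1$. A bimodule connection $(\nabla,\sigma)$ on $\Omega^1$ is a linear map $\nabla:\Omega^1\to\Omega^1\otimes_A\Omega^1$ and a bimodule map $\sigma:\Omega^1\otimes_A\Omega^1\to\Omega^1\otimes_A\Omega^1$ with $\nabla(a\omega)=\mathrm da\otimes\omega+a\nabla\omega$, $\nabla(\omega a)=(\nabla\omega)a+\sigma(\omega\otimes\mathrm da)$. Set $\nabla_0=\mathrm d$, $\nabla_1=\nabla$, $\nabla_n=\nabla\otimes\mathrm{id}^{n-1}+\sigma_1(\mathrm{id}\otimes\nabla_{n-1})$, and $\nabla^0=\mathrm{id}_A$, $\nabla^ns=\nabla_{n-1}\nabla^{n-1}s=\nabla_{n-1}\cdots\nabla_1\mathrm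 ds$. Braided binomials: bimodule maps on $\Omega^{1\otimes_An}$ with $\left[{n\atop0},\sigma\right]=\left[{n\atop n},\sigma\right]=\mathrm{id}^n$ and, for $0<k<n$, $\left[{n\atop k},\sigma\right]=\left(\mathrm{id}\otimes\left[{n-1\atop k-1},\sigma\right]\right)\sigma_1\cdots\sigma_{n-k}+\mathrm{id}\otimes\left[{n-1\atop k},\sigma\right]$. *)

(* Defs.v *)
From HB Require Import structures.
From mathcomp Require Import all_boot all_order all_algebra generic_quotient.
From mathcomp Require Import boolp.

Set Implicit Arguments.
Unset Strict Implicit.
Unset Printing Implicit Defensive.

Import GRing.Theory.
Local Open Scope ring_scope.
Local Open Scope quotient_scope.

Reserved Notation "a *> m" (at level 40, left associativity).
Reserved Notation "m <* a" (at level 40, left associativity).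


(* Bimodules over a k-algebra; the last two axioms say that the two induced
   k-vector space structures agree with the given one. *)
HB.mixin Record Lmodule_isBimodule (k : fieldType) (A : algType k) M
    of GRing.Lmodule k M := {
  lact : A -> M -> M;
  ract : M -> A -> M;
  lactDl : forall a b m, lact (a + b) m = lact a m + lact b m;
  lactDr : forall a m n, lact a (m + n) = lact a m + lact a n;
  lact1 : forall m, lact 1 m = m;
  lactA : forall a b m, lact (a * b) m = lact a (lact b m);
  ractDl : forall m n a, ract (m + n) a = ract m a + ract n a;
  ractDr : forall m a b, ract m (a + b) = ract m a + ract m b;
  ract1 : forall m, ract m 1 = m;
  ractA : forall m a b, ract m (a * b) = ract (ract m a) b;
  lractA : forall a m b, ract (lact a m) b = lact a (ract m b);
  lact_scalar : forall (c : k) m, lact c%:A m = c *: m;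
  ract_scalar : forall m (c : k), ract m c%:A = c *: m
}.

#[short(type="bimodType")]
HB.structure Definition Bimodule (k : fieldType) (A : algType k) :=
  {M of GRing.Lmodule k M & Lmodule_isBimodule k A M}.

Notation "a *> m" := (lact a m) : ring_scope.
Notation "m <* a" := (ract m a) : ring_scope.

Section RegularBimodule.
Variables (k : fieldType) (A : algType k).

Lemma reg_lact_scalar (c : k) (a : A) : c%:A * a = c *: a.
Proof. by rewrite -scalerAl mul1r. Qed.

Lemma reg_ract_scalar (a : A) (c : k) : a * c%:A = c *: a.
Proof. by rewrite -scalerAr mulr1. Qed.

Definition reg_isBimodule : Lmodule_isBimodule k A A :=
  Lmodule_isBimodule.Build k A A
    (fun a b c => mulrDl a b c) (fun a b c => mulrDr a b c)
    (fun a => mul1r a) (fun a b c => esym (mulrA a b c))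
    (fun a b c => mulrDl a b c) (fun a b c => mulrDr a b c)
    (fun a => mulr1 a) (fun a b c => mulrA a b c)
    (fun a b c => esym (mulrA a b c)) reg_lact_scalar reg_ract_scalar.

Definition reg_bimod : bimodType A := HB.pack (GRing.Algebra.sort A) reg_isBimodule.

End RegularBimodule.


Section BalancedTensor.
Variables (k : fieldType) (A : algType k).

Record balanced (M N : bimodType A) (Z : zmodType) (f : M -> N -> Z) : Prop :=
  Balanced {
    balDl : forall m m' n, f (m + m') n = f m n + f m' n;
    balDr : forall m n n', f m (n + n') = f m n + f m n';
    balA : forall m a n, f (m <* a) n = f m (a *> n)
  }.

Variables M N : bimodType A.

(* A finite sequence of pairs (m_i, n_i) stands for \sum_i m_i (x) n_i. *)
Inductive tens_eqv : seq (M * N) -> seq (M * N) -> Prop :=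
| te_refl s : tens_eqv s s
| te_sym s t : tens_eqv s t -> tens_eqv t s
| te_trans s t u : tens_eqv s t -> tens_eqv t u -> tens_eqv s u
| te_cat s s' t t' :
    tens_eqv s s' -> tens_eqv t t' -> tens_eqv (s ++ t) (s' ++ t')
| te_catC s t : tens_eqv (s ++ t) (t ++ s)
| te_Dl m m' n : tens_eqv [:: (m + m', n)] [:: (m, n); (m', n)]
| te_Dr m n n' : tens_eqv [:: (m, n + n')] [:: (m, n); (m, n')]
| te_A m a n : tens_eqv [:: (m <* a, n)] [:: (m, a *> n)]
| te_0 n : tens_eqv [:: (0, n)] [::].

Definition tens_eqvb : rel (seq (M * N)) := fun s t => `[< tens_eqv s t >].

Lemma tens_eqvb_refl : reflexive tens_eqvb.
Proof. by move=> s; apply/asboolP; apply: te_refl. Qed.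

Lemma tens_eqvb_sym : symmetric tens_eqvb.
Proof. by move=> s t; apply/asboolP/asboolP; apply: te_sym. Qed.

Lemma tens_eqvb_trans : transitive tens_eqvb.
Proof.
by move=> t s u /asboolP st /asboolP tu; apply/asboolP; apply: te_trans st tu.
Qed.

Canonical tens_equiv :=
  EquivRel tens_eqvb tens_eqvb_refl tens_eqvb_sym tens_eqvb_trans.

Definition tens := {eq_quot tens_equiv}.
HB.instance Definition _ := Choice.on tens.

Definition tens_sum (s : seq (M * N)) : tens := \pi_({eq_quot tens_equiv}) s.
Definition tens_repr (x : tens) : seq (M * N) := repr x.

Lemma tens_reprK x : tens_sum (tens_repr x) = x.
Proof. exact: reprK. Qed.

Lemma tens_sumP s t : tens_sum s = tens_sum t <-> tens_eqv s t.
Proof.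
split=> [/eqquotP/asboolP // | st].
by apply/eqquotP; apply/asboolP.
Qed.

Lemma tens_repr_sum s : tens_eqv (tens_repr (tens_sum s)) s.
Proof. by apply/tens_sumP; rewrite tens_reprK. Qed.

Definition pure m n : tens := tens_sum [:: (m, n)].

Definition tens_add x y := tens_sum (tens_repr x ++ tens_repr y).

Definition tens_map (f : M -> M) (g : N -> N) (x : tens) : tens :=
  tens_sum [seq (f p.1, g p.2) | p <- tens_repr x].

Lemma tens_addE s t : tens_add (tens_sum s) (tens_sum t) = tens_sum (s ++ t).
Proof. by apply/tens_sumP; apply: te_cat; apply: tens_repr_sum. Qed.

Lemma tens_sum_cons p s :
  tens_sum (p :: s) = tens_add (pure p.1 p.2) (tens_sum s).
Proof. by rewrite tens_addE; case: p. Qed.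

Lemma tens_addA : associative tens_add.
Proof.
move=> x y z; rewrite -[x]tens_reprK -[y]tens_reprK -[z]tens_reprK.
by rewrite !tens_addE catA.
Qed.

Lemma tens_addC : commutative tens_add.
Proof. by move=> x y; apply/tens_sumP; apply: te_catC. Qed.

Lemma tens_add0 : left_id (tens_sum [::]) tens_add.
Proof. by move=> x; rewrite -[x]tens_reprK tens_addE. Qed.

Lemma pureDl0 m m' n : pure (m + m') n = tens_add (pure m n) (pure m' n).
Proof. by rewrite tens_addE; apply/tens_sumP/te_Dl. Qed.

Lemma pureDr0 m n n' : pure m (n + n') = tens_add (pure m n) (pure m n').
Proof. by rewrite tens_addE; apply/tens_sumP/te_Dr. Qed.

Lemma pureA0 m a n : pure (m <* a) n = pure m (a *> n).
Proof. exact/tens_sumP/te_A. Qed.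

Lemma pure0l0 n : pure 0 n = tens_sum [::].
Proof. exact/tens_sumP/te_0. Qed.

Lemma tens_mapE (f : M -> M) (g : N -> N) :
  (forall m m', f (m + m') = f m + f m') -> (forall m a, f (m <* a) = f m <* a) ->
  (forall n n', g (n + n') = g n + g n') -> (forall a n, g (a *> n) = a *> g n) ->
  forall s, tens_map f g (tens_sum s) = tens_sum [seq (f p.1, g p.2) | p <- s].
Proof.
move=> fD fA gD gA s; apply/tens_sumP; move: (tens_repr_sum s).
move: (tens_repr _) => r; elim=> {r s} [s|s t _|s t u _ st _ tu|s s' t t' _ ss _ tt|s t|m m' n|m n n'|m a n|n].
- exact: te_refl.
- exact: te_sym.
- exact: te_trans st tu.
- by rewrite !map_cat; apply: te_cat.
- by rewrite !map_cat; apply: te_catC.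
- by rewrite /= fD; apply: te_Dl.
- by rewrite /= gD; apply: te_Dr.
- by rewrite /= fA gA; apply: te_A.
- have f0 : f 0 = 0 by apply: (addrI (f 0)); rewrite -fD !addr0.
  by rewrite /= f0; apply: te_0.
Qed.

Definition tens_opp := tens_map -%R id.

Lemma ractN (m : M) a : (- m) <* a = - (m <* a).
Proof.
apply: (addrI (m <* a)); rewrite -ractDl !subrr.
by apply: (addrI (0 <* a)); rewrite -ractDl !addr0.
Qed.

Lemma tens_oppE s : tens_opp (tens_sum s) = tens_sum [seq (- p.1, p.2) | p <- s].
Proof. by apply: tens_mapE => // *; rewrite ?opprD ?ractN. Qed.

Lemma tens_addN : left_inverse (tens_sum [::]) tens_opp tens_add.
Proof.
move=> x; rewrite -[x]tens_reprK tens_oppE; elim: (tens_repr x) => [|[m n] s IH].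
  by rewrite tens_addE.
rewrite /= !tens_sum_cons /= -tens_addA [tens_add (pure m n) _]tens_addC.
rewrite [tens_add (tens_sum _) _]tens_addA IH tens_add0 -pureDl0 addNr.
exact: pure0l0.
Qed.

HB.instance Definition _ :=
  GRing.isZmodule.Build tens tens_addA tens_addC tens_add0 tens_addN.

Lemma pureDl m m' n : pure (m + m') n = pure m n + pure m' n.
Proof. exact: pureDl0. Qed.

Lemma pureDr m n n' : pure m (n + n') = pure m n + pure m n'.
Proof. exact: pureDr0. Qed.

Lemma pureA m a n : pure (m <* a) n = pure m (a *> n).
Proof. exact: pureA0. Qed.

Lemma pure_balanced : balanced pure.
Proof. by split; [exact: pureDl | exact: pureDr | exact: pureA]. Qed.

Lemma tens_sumE s : tens_sum s = \sum_(p <- s) pure p.1 p.2.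
Proof. by elim: s => [|p s IH]; rewrite ?big_nil ?big_cons // tens_sum_cons IH. Qed.

Lemma tens_ind (P : tens -> Prop) :
  P 0 -> (forall m n x, P x -> P (pure m n + x)) -> forall x, P x.
Proof.
move=> P0 PD x; rewrite -[x]tens_reprK tens_sumE.
by elim: (tens_repr x) => [|p s IH]; rewrite ?big_nil ?big_cons //; apply: PD.
Qed.

Lemma tens_map_pure (f : M -> M) (g : N -> N) :
  (forall m m', f (m + m') = f m + f m') -> (forall m a, f (m <* a) = f m <* a) ->
  (forall n n', g (n + n') = g n + g n') -> (forall a n, g (a *> n) = a *> g n) ->
  (forall x y, tens_map f g (x + y) = tens_map f g x + tens_map f g y) *
  (forall m n, tens_map f g (pure m n) = pure (f m) (g n)).
Proof.
move=> fD fA gD gA; have E := tens_mapE fD fA gD gA; split=> [x y|m n].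
  rewrite -[x]tens_reprK -[y]tens_reprK [_ + _]tens_addE !E map_cat.
  by rewrite -tens_addE.
exact: E.
Qed.

Lemma ract0l a : (0 : M) <* a = 0.
Proof. by apply: (addrI (0 <* a)); rewrite -ractDl !addr0. Qed.
Lemma lact0r a : a *> (0 : N) = 0.
Proof. by apply: (addrI (a *> 0)); rewrite -lactDr !addr0. Qed.

Lemma ractZ c (m : M) a : (c *: m) <* a = c *: (m <* a).
Proof. by rewrite -!lact_scalar lractA. Qed.

Definition tens_scale (c : k) := tens_map (fun m => c *: m) id.
Definition tens_lact (a : A) := tens_map (fun m => a *> m) id.
Definition tens_ract (x : tens) (b : A) := tens_map id (fun n => n <* b) x.

Lemma tens_scaleP c :
  (forall x y, tens_scale c (x + y) = tens_scale c x + tens_scale c y) *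
  (forall m n, tens_scale c (pure m n) = pure (c *: m) n).
Proof. by apply: tens_map_pure => // *; rewrite ?scalerDr ?ractZ. Qed.

Lemma tens_lactP a :
  (forall x y, tens_lact a (x + y) = tens_lact a x + tens_lact a y) *
  (forall m n, tens_lact a (pure m n) = pure (a *> m) n).
Proof. by apply: tens_map_pure => // *; rewrite ?lactDr ?lractA. Qed.

Lemma tens_ractP a :
  (forall x y, tens_ract (x + y) a = tens_ract x a + tens_ract y a) *
  (forall m n, tens_ract (pure m n) a = pure m (n <* a)).
Proof. by apply: tens_map_pure => // *; rewrite ?ractDl ?lractA. Qed.

Lemma tens_additive_eq (Z : zmodType) (f g : tens -> Z) :
  (forall x y, f (x + y) = f x + f y) -> (forall x y, g (x + y) = g x + g y) ->
  (forall m n, f (pure m n) = g (pure m n)) -> f =1 g.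
Proof.
have h0 (h : tens -> Z) : (forall x y, h (x + y) = h x + h y) -> h 0 = 0.
  by move=> hD; apply: (addrI (h 0)); rewrite -hD !addr0.
move=> fD gD fg; elim/tens_ind => [|m n x IH]; first by rewrite !h0.
by rewrite fD gD fg IH.
Qed.

Let addD (f g : tens -> tens) :
  (forall x y, f (x + y) = f x + f y) -> (forall x y, g (x + y) = g x + g y) ->
  forall x y, f (x + y) + g (x + y) = (f x + g x) + (f y + g y).
Proof. by move=> fD gD x y; rewrite fD gD addrACA. Qed.

Lemma tens_scaleA a b x :
  tens_scale a (tens_scale b x) = tens_scale (a * b) x.
Proof.
move: x; apply: tens_additive_eq => *; rewrite !tens_scaleP // scalerA //.
Qed.

Lemma tens_scale1 : left_id 1 tens_scale.
Proof. by apply: tens_additive_eq => // *; rewrite !tens_scaleP // scale1r. Qed.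

Lemma tens_scaleDr : right_distributive tens_scale +%R.
Proof. by move=> c x y; rewrite tens_scaleP. Qed.

Lemma tens_scaleDl x : {morph tens_scale^~ x : a b / a + b}.
Proof.
move=> a b; move: x; apply: tens_additive_eq => [x y|x y|m n] /=.
- by rewrite tens_scaleP.
- by rewrite !tens_scaleP addrACA.
- by rewrite !tens_scaleP scalerDl pureDl.
Qed.

HB.instance Definition _ := GRing.Zmodule_isLmodule.Build k tens
  tens_scaleA tens_scale1 tens_scaleDr tens_scaleDl.

Lemma pureZl c m n : pure (c *: m) n = c *: pure m n.
Proof. by rewrite [RHS]tens_scaleP. Qed.

Lemma pureZr c m n : pure m (c *: n) = c *: pure m n.
Proof. by rewrite -lact_scalar -pureA ract_scalar pureZl. Qed.

Lemma tens_lactDl a b x : tens_lact (a + b) x = tens_lact a x + tens_lact b x.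
Proof.
move: x; apply: tens_additive_eq => [x y|x y|m n].
- by rewrite tens_lactP.
- by rewrite !tens_lactP addrACA.
- by rewrite !tens_lactP lactDl pureDl.
Qed.

Lemma tens_lactDr a x y : tens_lact a (x + y) = tens_lact a x + tens_lact a y.
Proof. by rewrite tens_lactP. Qed.

Lemma tens_lact1 x : tens_lact 1 x = x.
Proof. by move: x; apply: tens_additive_eq => // *; rewrite tens_lactP // lact1. Qed.

Lemma tens_lactA a b x : tens_lact (a * b) x = tens_lact a (tens_lact b x).
Proof. by move: x; apply: tens_additive_eq => *; rewrite !tens_lactP // lactA. Qed.

Lemma tens_ractDl x y a : tens_ract (x + y) a = tens_ract x a + tens_ract y a.
Proof. by rewrite tens_ractP. Qed.

Lemma tens_ractDr x a b : tens_ract x (a + b) = tens_ract x a + tens_ract x b.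
Proof.
move: x; apply: tens_additive_eq => [x y|x y|m n].
- by rewrite tens_ractP.
- by rewrite !tens_ractP addrACA.
- by rewrite !tens_ractP ractDr pureDr.
Qed.

Lemma tens_ract1 x : tens_ract x 1 = x.
Proof. by move: x; apply: tens_additive_eq => // *; rewrite tens_ractP // ract1. Qed.

Lemma tens_ractA x a b : tens_ract x (a * b) = tens_ract (tens_ract x a) b.
Proof. by move: x; apply: tens_additive_eq => *; rewrite !tens_ractP // ractA. Qed.

Lemma tens_lractA a x b :
  tens_ract (tens_lact a x) b = tens_lact a (tens_ract x b).
Proof.
by move: x; apply: tens_additive_eq => *; rewrite ?(tens_lactP, tens_ractP).
Qed.

Lemma tens_lact_scalar (c : k) x : tens_lact c%:A x = c *: x.
Proof.
move: x; apply: tens_additive_eq => *; rewrite ?tens_lactP ?scalerDr //.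
by rewrite lact_scalar pureZl.
Qed.

Lemma tens_ract_scalar x (c : k) : tens_ract x c%:A = c *: x.
Proof.
move: x; apply: tens_additive_eq => *; rewrite ?tens_ractP ?scalerDr //.
by rewrite ract_scalar pureZr.
Qed.

HB.instance Definition _ := Lmodule_isBimodule.Build k A tens
  tens_lactDl tens_lactDr tens_lact1 tens_lactA
  tens_ractDl tens_ractDr tens_ract1 tens_ractA
  tens_lractA tens_lact_scalar tens_ract_scalar.

Lemma lact_pure a m n : a *> pure m n = pure (a *> m) n.
Proof. by rewrite [LHS]tens_lactP. Qed.

Lemma ract_pure m n a : pure m n <* a = pure m (n <* a).
Proof. by rewrite [LHS]tens_ractP. Qed.

Definition tens_lift (Z : zmodType) (f : M -> N -> Z) (x : tens) : Z :=
  \sum_(p <- tens_repr x) f p.1 p.2.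

Lemma tens_lift_sum (Z : zmodType) (f : M -> N -> Z) : balanced f ->
  forall s, tens_lift f (tens_sum s) = \sum_(p <- s) f p.1 p.2.
Proof.
move=> [fDl fDr fA] s; rewrite /tens_lift; move: (tens_repr_sum s).
move: (tens_repr _) => r; elim=> {r s} [s|s t _|s t u _ st _ tu|s s' t t' _ ss _ tt|s t|m m' n|m n n'|m a n|n].
- by [].
- by [].
- by rewrite st.
- by rewrite !big_cat /= ss tt.
- by rewrite !big_cat /= addrC.
- by rewrite !big_cons !big_nil /= fDl !addr0.
- by rewrite !big_cons !big_nil /= fDr !addr0.
- by rewrite !big_cons !big_nil /= fA.
- rewrite big_cons !big_nil /= addr0.
  by apply: (addrI (f 0 n)); rewrite -fDl !addr0.
Qed.

Lemma tens_liftD (Z : zmodType) (f : M -> N -> Z) : balanced f ->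
  forall x y, tens_lift f (x + y) = tens_lift f x + tens_lift f y.
Proof.
move=> fb x y; rewrite -[x]tens_reprK -[y]tens_reprK [_ + _]tens_addE.
by rewrite !(tens_lift_sum fb) big_cat.
Qed.

Lemma tens_liftE (Z : zmodType) (f : M -> N -> Z) : balanced f ->
  forall m n, tens_lift f (pure m n) = f m n.
Proof. by move=> fb m n; rewrite (tens_lift_sum fb) big_seq1. Qed.

End BalancedTensor.

Arguments pure {k A M N} m n.
Arguments tens_lift {k A M N Z} f x.


Section TensorPowers.
Variables (k : fieldType) (A : algType k) (M : bimodType A).

(* M^{(x)0} = A, M^{(x)1} = M, and right-nested above. *)
Fixpoint tpow (n : nat) : bimodType A :=
  match n with
  | 0 => reg_bimod A
  | n'.+1 => match n' with 0 => M | _ => tens M (tpow n') end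
  end.

Definition tcons (n : nat) : M -> tpow n -> tpow n.+1 :=
  match n return M -> tpow n -> tpow n.+1 with
  | 0 => fun x a => x <* a
  | _.+1 => fun x t => pure x t
  end.

(* The additive map with tcons x t |-> f x t, for balanced f (see tfoldE). *)
Definition tfold (n : nat) (Z : zmodType) :
    (M -> tpow n -> Z) -> tpow n.+1 -> Z :=
  match n return (M -> tpow n -> Z) -> tpow n.+1 -> Z with
  | 0 => fun f x => f x (1 : A)
  | _.+1 => fun f x => tens_lift f x
  end.

(* The concatenation M^{(x)m} x M^{(x)n} -> M^{(x)(m+n)}. *)
Fixpoint tcat (m n : nat) : tpow m -> tpow n -> tpow (m + n) :=
  match m return tpow m -> tpow n -> tpow (m + n) with
  | 0 => fun a t => a *> t
  | m'.+1 => fun s t => tfold (fun x u => tcons x (tcat u t)) s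
  end.

Definition pow_cast (m n : nat) (e : m = n) (t : tpow m) : tpow n :=
  ecast i (tpow i) e t.

(* id (x) phi. *)
Definition tid (m n : nat) (phi : tpow m -> tpow n) : tpow m.+1 -> tpow n.+1 :=
  tfold (fun x t => tcons x (phi t)).

Lemma tcons_balanced n : balanced (@tcons n).
Proof.
case: n => [|n]; last exact: pure_balanced.
by split=> [x y a|x a b|x a b] /=; rewrite ?ractDl ?ractDr -?ractA.
Qed.

Lemma lact_tcons n a x (t : tpow n) : a *> tcons x t = tcons (a *> x) t.
Proof. by case: n t => [|n] t /=; rewrite ?lact_pure ?lractA. Qed.

Lemma ract_tcons n a x (t : tpow n) : tcons x t <* a = tcons x (t <* a).
Proof. by case: n t => [|n] t /=; rewrite ?ract_pure -?ractA. Qed.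

Lemma tpow_ind n (P : tpow n.+1 -> Prop) :
  P 0 -> (forall x t u, P u -> P (tcons x t + u)) -> forall u, P u.
Proof.
case: n P => [|n] P P0 PD u; last exact: tens_ind.
by rewrite -[u]addr0 -{1}[u]ract1; apply: (PD u (1 : A)).
Qed.

Section Fold.
Variables (n : nat) (Z : zmodType) (f : M -> tpow n -> Z).
Hypothesis fb : balanced f.

Lemma tfoldD s t : tfold f (s + t) = tfold f s + tfold f t.
Proof. by case: n f fb s t => [|m] g gb s t /=; [rewrite (balDl gb) | apply: tens_liftD]. Qed.

Lemma tfold0 : tfold f 0 = 0.
Proof. by apply: (addrI (tfold f 0)); rewrite -tfoldD !addr0. Qed.

Lemma tfoldE x t : tfold f (tcons x t) = f x t.
Proof.
case: n f fb t => [|m] g gb t /=; last exact: tens_liftE.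
by rewrite (balA gb) [_ *> _]mulr1.
Qed.

End Fold.

Lemma tcat_props m n :
  (forall s s' (t : tpow n), @tcat m n (s + s') t = tcat s t + tcat s' t) *
  (forall s (t t' : tpow n), @tcat m n s (t + t') = tcat s t + tcat s t') *
  (forall a s (t : tpow n), @tcat m n (a *> s) t = a *> tcat s t) *
  (forall a s (t : tpow n), @tcat m n s t <* a = tcat s (t <* a)) *
  (forall s a (t : tpow n), @tcat m n (s <* a) t = tcat s (a *> t)) *
  (forall t : tpow n, balanced (fun x (u : tpow m) => tcons x (tcat u t))).
Proof.
have bal p : (forall s s' (t : tpow n), @tcat p n (s + s') t = tcat s t + tcat s' t) ->
  (forall a s (t : tpow n), @tcat p n (a *> s) t = a *> tcat s t) ->
  (forall t : tpow n, balanced (fun x (u : tpow p) => tcons x (tcat u t))).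
  move=> HD HA t; have [cDl cDr cA] := tcons_balanced (p + n).
  by split=> *; rewrite ?cDl ?HD ?cDr ?cA ?HA.
elim: m => [|m [[[[[IDl IDr] IL] IR] IA] Ib]].
  have D0 s s' (t : tpow n) : @tcat 0 n (s + s') t = tcat s t + tcat s' t.
    by rewrite /= lactDl.
  have L0 a s (t : tpow n) : @tcat 0 n (a *> s) t = a *> tcat s t.
    by rewrite /= -lactA.
  refine (D0, _, L0, _, _, bal _ D0 L0).
  - by move=> s t t'; rewrite /= lactDr.
  - by move=> a s t; rewrite /= lractA.
  - by move=> s a t; rewrite /= -lactA.
have D s s' (t : tpow n) : @tcat m.+1 n (s + s') t = tcat s t + tcat s' t.
  exact: tfoldD.
have Z0 (t : tpow n) : @tcat m.+1 n 0 t = 0 by exact: tfold0.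
have E x u (t : tpow n) : @tcat m.+1 n (tcons x u) t = tcons x (tcat u t).
  exact: tfoldE.
have [cDl cDr cA] := tcons_balanced (m + n).
have L a s (t : tpow n) : @tcat m.+1 n (a *> s) t = a *> tcat s t.
  elim/tpow_ind: s => [|x u s IH]; first by rewrite !(lact0r, Z0).
  rewrite lactDr !D IH lactDr lact_tcons; congr (_ + _).
  by rewrite E [in RHS]E [RHS]lact_tcons.
refine (D, _, L, _, _, bal _ D L).
- move=> s t t'; elim/tpow_ind: s => [|x u s IH]; first by rewrite !Z0 addr0.
  by rewrite !D IH addrACA !E IDr cDr.
- move=> a s t; elim/tpow_ind: s => [|x u s IH]; first by rewrite !Z0 ract0l.
  by rewrite !D ractDl IH; congr (_ + _); rewrite !E [LHS]ract_tcons IR.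
- move=> s a t; elim/tpow_ind: s => [|x u s IH]; first by rewrite ract0l !Z0.
  by rewrite ractDl !D IH; congr (_ + _); rewrite ract_tcons !E IA.
Qed.

Lemma tcatDl m n (s s' : tpow m) (t : tpow n) :
  tcat (s + s') t = tcat s t + tcat s' t.
Proof. exact: ((tcat_props m n).1.1.1.1.1 s s' t). Qed.

Lemma tcatDr m n (s : tpow m) (t t' : tpow n) :
  tcat s (t + t') = tcat s t + tcat s t'.
Proof. exact: ((tcat_props m n).1.1.1.1.2 s t t'). Qed.

Lemma lact_tcat m n a (s : tpow m) (t : tpow n) : a *> tcat s t = tcat (a *> s) t.
Proof. by rewrite (tcat_props m n).1.1.1.2. Qed.

Lemma ract_tcat m n a (s : tpow m) (t : tpow n) : tcat s t <* a = tcat s (t <* a).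
Proof. by rewrite (tcat_props m n).1.1.2. Qed.

Lemma tcatA m n (s : tpow m) a (t : tpow n) : tcat (s <* a) t = tcat s (a *> t).
Proof. exact: ((tcat_props m n).1.2 s a t). Qed.

Lemma tcat_tcons m n x (u : tpow m) (t : tpow n) :
  tcat (tcons x u) t = tcons x (tcat u t).
Proof. by apply: tfoldE; case: (tcat_props m n). Qed.

Lemma tcat20 (s : tpow 2) (a : A) : @tcat 2 0 s a = s <* a.
Proof.
elim/(@tpow_ind 1): s => [|x u s IH].
  by rewrite ract0l; apply: (addrI (@tcat 2 0 0 a)); rewrite -tcatDl !addr0.
rewrite tcatDl ractDl IH (@tcat_tcons 1 0) ract_tcons; congr (tcons _ _ + _).
by rewrite /= [_ *> _]mul1r.
Qed.

Section Id.
Variables (m n : nat) (phi : tpow m -> tpow n).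
Hypothesis phiD : forall s t, phi (s + t) = phi s + phi t.
Hypothesis phiA : forall a t, phi (a *> t) = a *> phi t.

Lemma tid_balanced : balanced (fun x t => tcons x (phi t)).
Proof.
have [cDl cDr cA] := tcons_balanced n.
by split=> *; rewrite ?cDl ?phiD ?cDr ?cA ?phiA.
Qed.

Lemma tidD s t : tid phi (s + t) = tid phi s + tid phi t.
Proof. exact: tfoldD tid_balanced _ _. Qed.

Lemma tid_tcons x t : tid phi (tcons x t) = tcons x (phi t).
Proof. exact: tfoldE tid_balanced _ _. Qed.

Lemma tid_lact a t : tid phi (a *> t) = a *> tid phi t.
Proof.
elim/tpow_ind: t => [|x t u IH].
  by rewrite lact0r /tid (tfold0 tid_balanced) lact0r.
by rewrite lactDr !tidD IH lactDr lact_tcons !tid_tcons lact_tcons.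
Qed.

End Id.


Record bimod_map (N P : bimodType A) := BimodMap {
  bmap :> {linear N -> P};
  bmap_lact : forall a x, bmap (a *> x) = a *> bmap x;
  bmap_ract : forall x a, bmap (x <* a) = bmap x <* a
}.

Variable sigma : bimod_map (tens M M) (tens M M).

(* sigma (x) id^n. *)
Definition braid1 (n : nat) : tpow n.+2 -> tpow n.+2 :=
  @tfold n.+1 (tpow n.+2)
    (fun x => @tfold n (tpow n.+2) (fun y t => @tcat 2 n (sigma (pure x y)) t)).

(* sigma in the tensor factors i, i+1, counted from 1; the identity if these
   factors do not exist. *)
Fixpoint braid (i n : nat) : tpow n -> tpow n :=
  match i, n return tpow n -> tpow n with
  | 1, n'.+2 => @braid1 n'
  | i'.+1, n'.+1 => tid (@braid i' n')
  | _, _ => id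
  end.
Arguments braid i n t : clear implicits.

(* sigma_1 sigma_2 ... sigma_m. *)
Definition braids (m n : nat) : tpow n -> tpow n :=
  foldr (fun i phi => braid i n \o phi) id (iota 1 m).
Arguments braids m n t : clear implicits.

Fixpoint braid_binom (n j : nat) : tpow n -> tpow n :=
  match n return tpow n -> tpow n with
  | 0 => id
  | n'.+1 => fun t =>
      if (0 < j < n'.+1)%N then
        tid (@braid_binom n' j.-1) (braids (n'.+1 - j) n'.+1 t)
          + tid (@braid_binom n' j) t
      else t
  end.
Arguments braid_binom n j t : clear implicits.

Lemma braid1_balanced2 n (x : M) :
  balanced (fun y (t : tpow n) => @tcat 2 n (sigma (pure x y)) t).
Proof.
split=> [y y' t|y t t'|y a t].
- by rewrite pureDr raddfD; apply: (@tcatDl 2).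
- exact: (@tcatDr 2).
- by rewrite -ract_pure bmap_ract; apply: (@tcatA 2).
Qed.

Lemma braid1_balanced n :
  balanced (fun x => @tfold n (tpow n.+2)
    (fun y t => @tcat 2 n (sigma (pure x y)) t)).
Proof.
split=> [x x' u|x u u'|x a u].
- elim/tpow_ind: u => [|y t u IH].
    by rewrite !(tfold0 (braid1_balanced2 _ _)) addr0.
  rewrite !(tfoldD (braid1_balanced2 _ _)) IH addrACA; congr (_ + _).
  rewrite !(tfoldE (braid1_balanced2 _ _)) pureDl raddfD; exact: (@tcatDl 2).
- exact: tfoldD (braid1_balanced2 _ _) _ _.
- elim/tpow_ind: u => [|y t u IH].
    by rewrite lact0r !(tfold0 (braid1_balanced2 _ _)).
  rewrite lactDr !(tfoldD (braid1_balanced2 _ _)) IH lact_tcons.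
  by rewrite !(tfoldE (braid1_balanced2 _ _)) pureA.
Qed.

Lemma braid1D n (s t : tpow n.+2) : braid1 (s + t) = braid1 s + braid1 t.
Proof. exact: tfoldD (braid1_balanced n) _ _. Qed.

Lemma braid1_tcons n x y (t : tpow n) :
  braid1 (tcons x (tcons y t)) = @tcat 2 n (sigma (pure x y)) t.
Proof.
by rewrite [LHS](tfoldE (braid1_balanced n)) (tfoldE (braid1_balanced2 _ _)).
Qed.

Lemma braid1_lact n a (t : tpow n.+2) : braid1 (a *> t) = a *> braid1 t.
Proof.
elim/tpow_ind: t => [|x u t IH].
  by rewrite lact0r /braid1 (tfold0 (braid1_balanced n)) lact0r.
rewrite lactDr !braid1D IH lactDr; congr (_ + _); rewrite lact_tcons.
elim/tpow_ind: u {IH t} => [|y s u IH].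
  by rewrite /braid1 !(tfoldE (braid1_balanced n)) !tfold0 ?lact0r //;
    apply: braid1_balanced2.
have [_ cDr _] := tcons_balanced n.+1.
rewrite !cDr !braid1D IH lactDr; congr (_ + _); rewrite !braid1_tcons.
by rewrite -lact_pure bmap_lact [RHS](@lact_tcat 2).
Qed.

Lemma braid_bimod i n :
  (forall s t, braid i n (s + t) = braid i n s + braid i n t) /\
  (forall a t, braid i n (a *> t) = a *> braid i n t).
Proof.
elim: i n => [|i IH] n; first by split.
case: n => [|n]; first by case: i {IH} => [|i]; split.
have H : (forall s t, tid (braid i n) (s + t) =
                      tid (braid i n) s + tid (braid i n) t) /\
         (forall a t, tid (braid i n) (a *> t) = a *> tid (braid i n) t).
  have [bD bA] := IH n; split; first exact: tidD.
  by move=> a t; apply: tid_lact.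
by case: i n IH H => [|i] [|n] IH H //; split;
  [exact: braid1D | exact: braid1_lact].
Qed.

Lemma braid12 (t : tpow 2) : braid 1 2 t = sigma t.
Proof.
elim/(@tpow_ind 1): t => [|x y t IH].
  by rewrite raddf0; apply: (tfold0 (braid1_balanced 0)).
rewrite [LHS]braid1D raddfD; congr (_ + _); last exact: IH.
by rewrite -[y in LHS]ract1 [LHS](@braid1_tcons 0 x y (1 : A)) tcat20 ract1.
Qed.

Lemma braids_bimod m n :
  (forall s t, braids m n (s + t) = braids m n s + braids m n t) /\
  (forall a t, braids m n (a *> t) = a *> braids m n t).
Proof.
rewrite /braids; elim: (iota 1 m) => [|i l [IHD IHA]] //=.
have [bD bA] := braid_bimod i n.
by split=> *; rewrite ?IHD ?bD ?IHA ?bA.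
Qed.

Lemma braid_binom_bimod n j :
  (forall s t, braid_binom n j (s + t) = braid_binom n j s + braid_binom n j t) /\
  (forall a t, braid_binom n j (a *> t) = a *> braid_binom n j t).
Proof.
elim: n j => [|n IH] j; first by split.
rewrite /=; case: (0 < j < n.+1)%N; last by split.
have [[D1 A1] [D2 A2]] := (IH j.-1, IH j).
have [bD bA] := braids_bimod (n.+1 - j) n.+1.
split=> [s t|a t].
  by rewrite bD (tidD D1 A1) (tidD D2 A2) addrACA.
by rewrite bA (tid_lact D1 A1) (tid_lact D2 A2) lactDr.
Qed.

Lemma braid_tcons i n x (t : tpow n) :
  braid i.+2 n.+1 (tcons x t) = tcons x (braid i.+1 n t).
Proof. by have [bD bA] := braid_bimod i.+1 n; exact: tid_tcons. Qed.

End TensorPowers.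

Arguments braid {k A M} sigma i n t.
Arguments braids {k A M} sigma m n t.
Arguments braid_binom {k A M} sigma n j t.


Definition graded_forms (k : fieldType) (A : algType k)
    (P : nat -> lmodType k) (n : nat) : lmodType k :=
  if n is n'.+1 then P n' else A.

Definition fcast (k : fieldType) (V : nat -> lmodType k) (m n : nat)
  (e : m = n) (x : V m) : V n := ecast i (V i) e x.
Arguments fcast {k V m n} e x.

Record dga (k : fieldType) (A : algType k) := Dga {
  pos_forms : nat -> lmodType k; (* Omega^{n+1} *)
  forms := graded_forms A pos_forms;
  wedge : forall m n, forms m -> forms n -> forms (m + n);
  dif : forall n, {linear forms n -> forms n.+1};
  wedgePl : forall m n c (x x' : forms m) (y : forms n),
    wedge (c *: x + x') y = c *: wedge x y + wedge x' y;
  wedgePr : forall m n c (x : forms m) (y y' : forms n),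
    wedge x (c *: y + y') = c *: wedge x y + wedge x y';
  wedgeA : forall m n p (x : forms m) (y : forms n) (z : forms p),
    fcast (addnA m n p) (wedge x (wedge y z)) = wedge (wedge x y) z;
  wedge00 : forall a b : A, @wedge 0 0 a b = a * b;
  wedge1l : forall n (x : forms n), @wedge 0 n (1 : A) x = x;
  wedge1r : forall n (x : forms n), fcast (addn0 n) (@wedge n 0 x (1 : A)) = x;
  difK : forall n (x : forms n), dif n.+1 (dif n x) = 0;
  dif_wedge : forall m n (x : forms m) (y : forms n),
    dif (m + n) (wedge x y) =
      (wedge (dif m x) y : forms (m + n).+1)
      + (-1) ^+ m *: fcast (addnS m n) (wedge x (dif n y));
  (* Omega is the smallest (graded) subalgebra containing A and dA. *)
  forms_generated : forall S : forall n, forms n -> Prop,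
    (forall a : A, S 0 a) -> (forall a : A, S 1 (dif 0 a)) ->
    (forall n, S n 0) ->
    (forall n c (x y : forms n), S n x -> S n y -> S n (c *: x + y)) ->
    (forall m n (x : forms m) (y : forms n),
       S m x -> S n y -> S (m + n) (wedge x y)) ->
    forall n (x : forms n), S n x
}.

Section OneForms.
Variables (k : fieldType) (A : algType k) (Om : dga A).

Let F := forms Om.
Let la (a : A) (w : F 1) : F 1 := @wedge _ _ Om 0 1 a w.
Let ra (w : F 1) (a : A) : F 1 := @wedge _ _ Om 1 0 w a.

Lemma fcast_id n (e : n = n) (x : F n) : fcast e x = x.
Proof. by rewrite /fcast (eq_irrelevance e erefl). Qed.

Let waddl m n (x x' : F m) (y : F n) : wedge (x + x') y = wedge x y + wedge x' y.
Proof. by have := wedgePl 1 x x' y; rewrite !scale1r. Qed.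

Let waddr m n (x : F m) (y y' : F n) : wedge x (y + y') = wedge x y + wedge x y'.
Proof. by have := wedgePr 1 x y y'; rewrite !scale1r. Qed.

Let w0l m n (y : F n) : wedge (0 : F m) y = 0.
Proof. by apply: (addrI (wedge (0 : F m) y)); rewrite -waddl !addr0. Qed.

Let w0r m n (x : F m) : wedge x (0 : F n) = 0.
Proof. by apply: (addrI (wedge x (0 : F n))); rewrite -waddr !addr0. Qed.

Let laDl a b m : la (a + b) m = la a m + la b m.
Proof. exact: (@waddl 0 1). Qed.
Let laDr a m n : la a (m + n) = la a m + la a n.
Proof. exact: (@waddr 0 1). Qed.
Let la1 m : la 1 m = m.
Proof. exact: (@wedge1l _ _ Om 1). Qed.
Let laA a b m : la (a * b) m = la a (la b m).
Proof.
have := @wedgeA _ _ Om 0 0 1 a b m.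
by rewrite (fcast_id (n := 1)) wedge00.
Qed.
Let raDl m n a : ra (m + n) a = ra m a + ra n a.
Proof. exact: (@waddl 1 0). Qed.
Let raDr m a b : ra m (a + b) = ra m a + ra m b.
Proof. exact: (@waddr 1 0). Qed.
Let ra1 m : ra m 1 = m.
Proof. by have := @wedge1r _ _ Om 1 m; rewrite (fcast_id (n := 1)). Qed.
Let raA m a b : ra m (a * b) = ra (ra m a) b.
Proof.
have := @wedgeA _ _ Om 1 0 0 m a b.
by rewrite (fcast_id (n := 1)) wedge00.
Qed.
Let lraA a m b : ra (la a m) b = la a (ra m b).
Proof. by have := @wedgeA _ _ Om 0 1 0 a m b; rewrite (fcast_id (n := 1)). Qed.
Let la_scalar (c : k) m : la c%:A m = c *: m.
Proof.
have := @wedgePl _ _ Om 0 1 c (1 : A) 0 m.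
by rewrite addr0 w0l addr0 wedge1l.
Qed.
Let ra_scalar m (c : k) : ra m c%:A = c *: m.
Proof.
have := @wedgePr _ _ Om 1 0 c m (1 : A) 0.
rewrite addr0 w0r addr0 => E; apply: (etrans E).
by congr (_ *: _); apply: ra1.
Qed.

Definition one_forms_isBimodule :=
  Lmodule_isBimodule.Build k A (forms Om 1)
    laDl laDr la1 laA raDl raDr ra1 raA lraA la_scalar ra_scalar.

(* Omega^1, with the actions of A by wedge product. *)
Definition one_forms : bimodType A :=
  HB.pack (GRing.Lmodule.sort (forms Om 1)) one_forms_isBimodule.

Definition dif0 (a : A) : one_forms := dif Om 0 a.

Local Notation "'T' n" := (tpow one_forms n) (at level 10, n at level 9).

Record bimod_conn := BimodConn {
  conn :> {linear one_forms -> T 2};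
  conn_braid : bimod_map (T 2) (T 2);
  conn_lact : forall a w, conn (a *> w) = pure (dif0 a) w + a *> conn w;
  conn_ract : forall w a,
    conn (w <* a) = conn w <* a + conn_braid (pure w (dif0 a))
}.

Variable nabla : bimod_conn.
Local Notation sigma := (conn_braid nabla).

(* The sum nabla (x) id + sigma_1 (id (x) nabla_{n-1}) descends to the tensor
   product although its summands do not. *)
Fixpoint nabla_ (n : nat) : T n -> T n.+1 :=
  match n return T n -> T n.+1 with
  | 0 => dif0
  | n'.+1 =>
      match n' return (T n' -> T n'.+1) -> T n'.+1 -> T n'.+2 with
      | 0 => fun _ => nabla
      | n''.+1 => fun nabla_n' =>
          @tens_lift _ _ one_forms (T n''.+1) (T n''.+3) (fun w t =>
            @tcat _ _ _ 2 n''.+1 (nabla w) t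
              + braid sigma 1 n''.+3 (tcons w (nabla_n' t)))
      end (@nabla_ n')
  end.
Arguments nabla_ n t : clear implicits.

Fixpoint nabla_pow (n : nat) (a : A) : T n :=
  match n return T n with
  | 0 => a
  | n'.+1 => nabla_ n' (nabla_pow n' a)
  end.

Definition leibniz_compatible : Prop :=
  forall t : T 2, nabla_ 2 (braid sigma 1 2 t) = braid sigma 2 3 (nabla_ 2 t).

Lemma dif0M a b : dif0 (a * b) = dif0 a <* b + a *> dif0 b.
Proof.
have := @dif_wedge _ _ Om 0 0 a b.
by rewrite wedge00 expr0 scale1r (fcast_id (n := 1)).
Qed.

Lemma nabla_bal n :
  (forall s t, nabla_ n (s + t) = nabla_ n s + nabla_ n t) *
  (forall a t, nabla_ n (a *> t) = tcons (dif0 a) t + a *> nabla_ n t) *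
  balanced (fun (w : one_forms) (t : T n) =>
     @tcat _ _ _ 2 n (nabla w) t + braid sigma 1 n.+2 (tcons w (nabla_ n t))).
Proof.
have b1D := fun m => (braid_bimod sigma 1 m.+2).1.
have bal m : (forall s t, nabla_ m (s + t) = nabla_ m s + nabla_ m t) ->
  (forall a t, nabla_ m (a *> t) = tcons (dif0 a) t + a *> nabla_ m t) ->
  balanced (fun (w : one_forms) (t : T m) =>
     @tcat _ _ _ 2 m (nabla w) t + braid sigma 1 m.+2 (tcons w (nabla_ m t))).
  move=> HD HA; have [cDl cDr cA] := tcons_balanced one_forms m.+1.
  split=> [w w' t|w t t'|w a t].
  - by rewrite raddfD cDl b1D addrACA; congr (_ + _); apply: (@tcatDl _ _ _ 2).
  - by rewrite HD cDr b1D addrACA; congr (_ + _); apply: (@tcatDr _ _ _ 2).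
  - rewrite conn_ract HA cDr b1D cA [tcat (_ + _) _](@tcatDl _ _ _ 2).
    rewrite [tcat (_ <* _) _](@tcatA _ _ _ 2) -addrA; congr (_ + (_ + _)).
    by rewrite [RHS]braid1_tcons.
elim: n => [|n [[ID IL] Ib]].
  have D0 s t : nabla_ 0 (s + t) = nabla_ 0 s + nabla_ 0 t by exact: raddfD.
  have L0 a t : nabla_ 0 (a *> t) = tcons (dif0 a) t + a *> nabla_ 0 t.
    exact: dif0M.
  exact: (D0, L0, bal _ D0 L0).
have D s t : nabla_ n.+1 (s + t) = nabla_ n.+1 s + nabla_ n.+1 t.
  by case: n ID IL Ib s t => [|n] *; [exact: raddfD | exact: tens_liftD].
have L a t : nabla_ n.+1 (a *> t) = tcons (dif0 a) t + a *> nabla_ n.+1 t.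
  case: n ID IL Ib t D => [|n] ID IL Ib t D; first exact: conn_lact.
  have E w u : nabla_ n.+2 (pure w u) = @tcat _ _ _ 2 n.+1 (nabla w) u
              + braid sigma 1 n.+3 (tcons w (nabla_ n.+1 u)).
    exact: tens_liftE.
  move: t; apply: tens_additive_eq => [x y|x y|w u].
  - by rewrite lactDr D.
  - by rewrite D lactDr [tcons _ _]pureDr addrACA.
  - rewrite lact_pure !E lactDr conn_lact [tcat (_ + _) _](@tcatDl _ _ _ 2).
    rewrite -addrA; congr (_ + _).
      rewrite (@tcat_tcons _ _ _ 1 n.+1 (dif0 a) w u); congr (tcons _ _).
      by rewrite /= ?lact1.
    congr (_ + _); first exact: (esym (@lact_tcat _ _ _ 2 n.+1 _ _ _)).
    by rewrite -lact_tcons (braid_bimod sigma 1 n.+3).2.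
exact: (D, L, bal _ D L).
Qed.

Lemma nabla_D n (s t : T n) : nabla_ n (s + t) = nabla_ n s + nabla_ n t.
Proof. exact: ((nabla_bal n).1.1 s t). Qed.

Lemma nabla_lact n a (t : T n) :
  nabla_ n (a *> t) = tcons (dif0 a) t + a *> nabla_ n t.
Proof. exact: ((nabla_bal n).1.2 a t). Qed.

Lemma nabla_tcons n (w : one_forms) (t : T n) :
  nabla_ n.+1 (tcons w t) =
    @tcat _ _ _ 2 n (nabla w) t + braid sigma 1 n.+2 (tcons w (nabla_ n t)).
Proof.
case: n t => [|n] t; last by rewrite [LHS](tens_liftE (nabla_bal n.+1).2).
by rewrite [LHS]conn_ract (braid12 sigma) tcat20.
Qed.

End OneForms.

(* Main.v *)
Require Import Defs.
From mathcomp Require Import all_boot all_algebra.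

Local Open Scope ring_scope.

Set Implicit Arguments.
Unset Strict Implicit.
Unset Printing Implicit Defensive.
Import GRing.Theory.

(** The theorem is proved like the classical Leibniz rule, by induction on n
    with a Pascal recursion.  Write s_i for sigma in the factors i, i+1.

    The connections satisfy a two-block Leibniz rule [nabla_tcat]: for s of
    degree m,
      nabla (s (x) t) = nabla s (x) t + s_1 ... s_m (s (x) nabla t),
    since the new one-form, which nabla inserts in front of t, has to be braided
    to the far left past the m factors of s.

    Leibniz compatibility, nabla_2 s_1 = s_2 nabla_2, must be propagated to all
    degrees.  Evaluating it on u a with a in A, the derivative of a produces the
    extra terms s_1 s_2 s_1 (u (x) da) and s_2 s_1 s_2 (u (x) da), so the braid
    relation holds on u (x) da; as Omega^1 is spanned by the elements (da) b, it
    holds everywhere [braid_rel].  With the braid relation, nabla s_1 = s_2 nabla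
    in every degree [intertwines_braid1].  Call an endomorphism phi of the n-th
    tensor power intertwining if nabla phi = (id (x) phi) nabla.  Such maps are
    stable under composition, sum and id (x) -, so all the braided binomials,
    built from the s_i by these operations, are intertwining
    [intertwines_binom].

    Applying nabla to the formula in degree n, one can thus push it through each
    binomial and use the two-block rule.  The term nabla^(n+1-j) a (x) nabla^j b
    then arises twice, with coefficients id (x) [n, j] and
    (id (x) [n, j-1]) s_1 ... s_(n+1-j), whose sum is [n+1, j] by definition. *)

(** * Sums *)

Lemma additive0 (U V : zmodType) (f : U -> V) :
  (forall x y, f (x + y) = f x + f y) -> f 0 = 0.
Proof. by move=> fD; apply: (addrI (f 0)); rewrite -fD !addr0. Qed.

(** Summation by Pascal's rule: P and Q are the two contributions of row n, and
    the contributions Q_i and P_(i+1) meet in entry i+1 of the row R below it. *)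
Lemma sum_pascal (Z : zmodType) n (P Q : 'I_n.+1 -> Z) (R : 'I_n.+2 -> Z) :
  P ord0 = R ord0 -> Q ord_max = R ord_max ->
  (forall i : 'I_n, Q (widen_ord (leqnSn n) i) + P (lift ord0 i) =
                    R (lift ord0 (widen_ord (leqnSn n) i))) ->
  \sum_i (P i + Q i) = \sum_i R i.
Proof.
move=> P0 Qn PQ; rewrite big_split /= big_ord_recl [X in _ + X = _]big_ord_recr /=.
rewrite [RHS]big_ord_recl [X in _ = _ + X]big_ord_recr /= -P0.
have -> : lift ord0 ord_max = ord_max :> 'I_n.+2 by apply: val_inj.
rewrite -Qn -addrA; congr (_ + _); rewrite addrA; congr (_ + _).
by rewrite -big_split /=; apply: eq_bigr => i _; rewrite addrC PQ.
Qed.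

(** * Tensor powers of a bimodule *)

Section TensorPowers.
Variables (k : fieldType) (A : algType k) (M : bimodType A).
Local Notation T n := (tpow M n).

Lemma tpow_additive_eq n (Z : zmodType) (f g : T n.+1 -> Z) :
  (forall x y, f (x + y) = f x + f y) -> (forall x y, g (x + y) = g x + g y) ->
  (forall x t, f (tcons x t) = g (tcons x t)) -> f =1 g.
Proof.
move=> fD gD fg; elim/tpow_ind => [|x t u IH]; last by rewrite fD gD fg IH.
by rewrite (additive0 fD) (additive0 gD).
Qed.

Lemma tconsDl n x y (t : T n) : tcons (x + y) t = tcons x t + tcons y t.
Proof. by have [cDl _ _] := tcons_balanced M n; apply: cDl. Qed.

Lemma tconsDr n x (s t : T n) : tcons x (s + t) = tcons x s + tcons x t.
Proof. by have [_ cDr _] := tcons_balanced M n; apply: cDr. Qed.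

Lemma tcat1l n (x : T 1) (t : T n) : tcat x t = tcons x t.
Proof. by rewrite /= lact1. Qed.

(** Associativity of concatenation, for a first block of concrete length: then
    both sides have convertible types, so that no cast appears. *)
Lemma tcat_tcat2 m n (s : T 2) (t : T m) (u : T n) :
  @tcat _ _ _ (2 + m) n (tcat s t) u = tcat s (tcat t u).
Proof.
move: s; apply: (@tpow_additive_eq 1).
- by move=> x y; rewrite (@tcatDl _ _ _ 2) (@tcatDl _ _ _ m.+2).
- by move=> x y; rewrite (@tcatDl _ _ _ 2).
move=> x y; rewrite !(@tcat_tcons _ _ _ 1) (@tcat_tcons _ _ _ m.+1) !tcat1l.
by rewrite (@tcat_tcons _ _ _ m).
Qed.

Lemma pow_castD m n (e : m = n) (s t : T m) :
  pow_cast e (s + t) = pow_cast e s + pow_cast e t.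
Proof. by case: n / e. Qed.

Lemma pow_cast_id n (e : n = n) (t : T n) : pow_cast e t = t.
Proof. by rewrite (eq_irrelevance e erefl). Qed.

Lemma pow_cast_tcons m n (e : m.+1 = n.+1) (e' : m = n) x (t : T m) :
  pow_cast e (tcons x t) = tcons x (pow_cast e' t).
Proof. by case: n / e' e => e; rewrite pow_cast_id. Qed.

Lemma tid_id n (f : T n -> T n) : (forall t, f t = t) -> forall t, tid f t = t.
Proof.
move=> fE; have fD s t : f (s + t) = f s + f t by rewrite !fE.
have fA a t : f (a *> t) = a *> f t by rewrite !fE.
by apply: tpow_additive_eq => *; rewrite ?tidD ?tid_tcons ?fE.
Qed.

Lemma tid_comp m n p (f : T n -> T p) (g : T m -> T n) :
  (forall s t, f (s + t) = f s + f t) -> (forall a t, f (a *> t) = a *> f t) ->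
  (forall s t, g (s + t) = g s + g t) -> (forall a t, g (a *> t) = a *> g t) ->
  tid (f \o g) =1 tid f \o tid g.
Proof.
move=> fD fA gD gA.
have hD s t : (f \o g) (s + t) = (f \o g) s + (f \o g) t by rewrite /= gD fD.
have hA a t : (f \o g) (a *> t) = a *> (f \o g) t by rewrite /= gA fA.
by apply: tpow_additive_eq => [s t|s t|x t] /=; rewrite ?tidD ?tid_tcons.
Qed.

Lemma tid_tid_tcat n p (phi : T n -> T p) :
  (forall s t, phi (s + t) = phi s + phi t) ->
  (forall a t, phi (a *> t) = a *> phi t) ->
  forall (s : T 2) (t : T n),
    tid (tid phi) (@tcat _ _ _ 2 n s t) = tcat s (phi t).
Proof.
move=> phiD phiA s t; have idD := tidD phiD phiA; have idA := tid_lact phiD phiA.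
move: s; apply: (@tpow_additive_eq 1).
- by move=> x y; rewrite (@tcatDl _ _ _ 2) tidD.
- by move=> x y; rewrite (@tcatDl _ _ _ 2).
by move=> x y; rewrite !(@tcat_tcons _ _ _ 1) !tcat1l !tid_tcons.
Qed.

(** * Braidings and braided binomials *)

Section Braid.
Variable sigma : bimod_map (tens M M) (tens M M).

Lemma braidD i n (s t : T n) :
  braid sigma i n (s + t) = braid sigma i n s + braid sigma i n t.
Proof. exact: (braid_bimod sigma i n).1. Qed.

Lemma braid_lact i n a (t : T n) :
  braid sigma i n (a *> t) = a *> braid sigma i n t.
Proof. exact: (braid_bimod sigma i n).2. Qed.

Lemma braidsD m n (s t : T n) :
  braids sigma m n (s + t) = braids sigma m n s + braids sigma m n t.
Proof. exact: (braids_bimod sigma m n).1. Qed.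

Lemma braid1_tcons2 n x y (t : T n) :
  braid sigma 1 n.+2 (tcons x (tcons y t)) = @tcat _ _ _ 2 n (sigma (pure x y)) t.
Proof. exact: braid1_tcons. Qed.

(** Operators on disjoint tensor factors commute. *)
Lemma braid_tid_tid n (phi : T n -> T n) :
  (forall s t, phi (s + t) = phi s + phi t) ->
  (forall a t, phi (a *> t) = a *> phi t) ->
  forall t, braid sigma 1 n.+2 (tid (tid phi) t) =
            tid (tid phi) (braid sigma 1 n.+2 t).
Proof.
move=> phiD phiA; have idD := tidD phiD phiA; have idA := tid_lact phiD phiA.
apply: tpow_additive_eq => [s t|s t|x].
- by rewrite tidD ?braidD.
- by rewrite braidD tidD.
apply: tpow_additive_eq => [s t|s t|y t].
- by rewrite tconsDr tidD ?braidD.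
- by rewrite tconsDr braidD tidD.
by rewrite !tid_tcons // !braid1_tcons2 tid_tid_tcat.
Qed.

Lemma braid_tcat i m n (s : T m.+1) (t : T n) : (i < m)%N ->
  braid sigma i.+1 (m.+1 + n) (tcat s t) = tcat (braid sigma i.+1 m.+1 s) t.
Proof.
elim: i m s => [|i IH] [|m] s // lim; move: s.
  apply: tpow_additive_eq => [s s'|s s'|x].
  - by rewrite (@tcatDl _ _ _ m.+2) (@braidD 1).
  - by rewrite (@braidD 1) (@tcatDl _ _ _ m.+2).
  apply: tpow_additive_eq => [s s'|s s'|y u].
  - by rewrite tconsDr (@tcatDl _ _ _ m.+2) (@braidD 1).
  - by rewrite tconsDr (@braidD 1) (@tcatDl _ _ _ m.+2).
  rewrite (@tcat_tcons _ _ _ m.+1) (@tcat_tcons _ _ _ m).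
  by rewrite (@braid1_tcons2 (m + n)) braid1_tcons2 tcat_tcat2.
apply: tpow_additive_eq => [s s'|s s'|x s].
- by rewrite (@tcatDl _ _ _ m.+2) (@braidD i.+2).
- by rewrite (@braidD i.+2) (@tcatDl _ _ _ m.+2).
rewrite (@tcat_tcons _ _ _ m.+1) (@braid_tcons _ _ _ _ i (m.+1 + n)).
by rewrite (@braid_tcons _ _ _ _ i m.+1) (@tcat_tcons _ _ _ m.+1) IH.
Qed.

Lemma braids_tcons m n x (t : T n) :
  braids sigma m.+1 n.+1 (tcons x t) =
    braid sigma 1 n.+1 (tcons x (braids sigma m n t)).
Proof.
(* The indices to be shifted start at p.+1, since braid_tcons concerns the
   braidings that do not involve the first factor. *)
pose fold r l := foldr (fun i phi => braid sigma i r \o phi) id l.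
suff shift p : fold n.+1 (iota p.+2 m) (tcons x t)
             = tcons x (fold n (iota p.+1 m) t).
  have -> : braids sigma m.+1 n.+1 (tcons x t) =
      braid sigma 1 n.+1 (fold n.+1 (iota 2 m) (tcons x t)) by [].
  by rewrite shift.
have foldE r i l u : fold r (i :: l) u = braid sigma i r (fold r l u) by [].
elim: m p => // m IH p; rewrite [iota p.+2 _]/= [iota p.+1 _]/=.
by rewrite !foldE IH braid_tcons.
Qed.

Lemma braid_binom0 n t : braid_binom sigma n 0 t = t.
Proof. by case: n t. Qed.

Lemma braid_binomn n t : braid_binom sigma n n t = t.
Proof. by case: n t => //= n t; rewrite ltnn. Qed.

Lemma braid_binomS n j t : (j < n)%N ->
  braid_binom sigma n.+1 j.+1 t =
    tid (braid_binom sigma n j) (braids sigma (n - j) n.+1 t)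
      + tid (braid_binom sigma n j.+1) t.
Proof. by move=> jn; rewrite /= ltnS jn. Qed.

End Braid.

End TensorPowers.

(** * One-forms *)

Section Connection.
Variables (k : fieldType) (A : algType k) (Om : dga A).
Local Notation T n := (tpow (one_forms Om) n).

Lemma ract0r (M : bimodType A) (m : M) : m <* 0 = 0.
Proof. by apply: (addrI (m <* 0)); rewrite -ractDr !addr0. Qed.

(** Omega^1 is spanned by the (da) b alone, because a db = d(ab) - (da) b. *)
Lemma dif0_span_ind (P : one_forms Om -> Prop) :
  P 0 -> (forall v w, P v -> P w -> P (v + w)) ->
  (forall a b, P (dif0 Om a <* b)) -> forall w, P w.
Proof.
move=> P0 PD Pd.
(* P itself is not assumed stable under the two actions of A, whereas the
   graded predicate has to be closed under wedge. *)
pose S n : forms Om n -> Prop :=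
  if n is 1 then fun w : one_forms Om => forall a c, P ((a *> w) <* c)
  else fun _ => True.
suff SP n w : S n w by move=> w; have := SP 1%N w 1 1; rewrite lact1 ract1.
apply: forms_generated n w => // [b|n|n c x y|m n x y].
- change (forall a c, P ((a *> dif0 Om b) <* c)) => a c.
  have -> : a *> dif0 Om b = dif0 Om (a * b) + dif0 Om a <* (- b).
    apply: (addIr (dif0 Om a <* b)); rewrite -addrA -ractDr addNr.
    by rewrite dif0M ract0r addr0 addrC.
  by rewrite ractDl -ractA; apply: PD; apply: Pd.
- by case: n => [|[|n]] // a c; rewrite lact0r ract0l.
- case: n x y => [|[|n]] // x y Sx Sy a b.
  have -> : c *: x + y = c%:A *> (x : one_forms Om) + y :> one_forms Om.
    by rewrite lact_scalar.
  by rewrite lactDr ractDl -lactA; apply: PD; [apply: Sx | apply: Sy].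
- case: m n x y => [|[|m]] [|[|n]] // x y Sx Sy.
    change (forall a c, P ((a *> (x *> (y : one_forms Om))) <* c)) => a c.
    by rewrite -lactA; apply: Sy.
  change (forall a c, P ((a *> ((x : one_forms Om) <* (y : A))) <* c)) => a c.
  by rewrite -lractA -ractA; apply: Sx.
Qed.

Lemma one_forms_additive_eq (Z : zmodType) (f g : one_forms Om -> Z) :
  (forall x y, f (x + y) = f x + f y) -> (forall x y, g (x + y) = g x + g y) ->
  (forall a b, f (dif0 Om a <* b) = g (dif0 Om a <* b)) -> f =1 g.
Proof.
move=> fD gD fg; apply: dif0_span_ind => [|v w IHv IHw|//].
  by rewrite (additive0 fD) (additive0 gD).
by rewrite fD gD IHv IHw.
Qed.

Variable nabla : bimod_conn Om.
Local Notation sigma := (conn_braid nabla).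
Local Notation "'del' n" := (@nabla_ k A Om nabla n) (at level 8, n at level 2).

(** * The Leibniz rule for a concatenation *)

(** For m = 0 this is the left Leibniz rule. Adding a factor x in front of s,
    nabla (x (x) s (x) t) is nabla x (x) s (x) t plus the image under s_1 of
    x (x) nabla (s (x) t), which prolongs the word s_1 ... s_m by one letter.
    The three casts are universally quantified, so that the rule applies in any
    context. *)
Lemma nabla_tcat m j n (e : (m + j = n)%N) (e1 : (m.+1 + j = n.+1)%N)
    (e2 : (m + j.+1 = n.+1)%N) (s : T m) (t : T j) :
  del n (pow_cast e (tcat s t)) =
    pow_cast e1 (tcat (del m s) t)
      + braids sigma m n.+1 (pow_cast e2 (tcat s (del j t))).
Proof.
case: n / e e1 e2 => e1 e2; rewrite (pow_cast_id erefl) (pow_cast_id e1) {e1}.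
elim: m s e2 => [|m IH] s e2.
  by rewrite pow_cast_id [LHS]nabla_lact -tcat1l.
move: s; apply: tpow_additive_eq => [s s'|s s'|x s].
- by rewrite (@tcatDl _ _ _ m.+1) nabla_D.
- by rewrite nabla_D (@tcatDl _ _ _ m.+2) (@tcatDl _ _ _ m.+1) pow_castD braidsD addrACA.
have e3 : (m + j.+1 = (m + j).+1)%N by rewrite addnS.
rewrite !(@tcat_tcons _ _ _ m) (pow_cast_tcons _ e3) (@nabla_tcons _ _ _ _ (m + j)).
rewrite braids_tcons IH nabla_tcons (@tcatDl _ _ _ m.+2) tcat_tcat2 -addrA.
by rewrite tconsDr braidD -(@braid_tcat _ _ _ sigma 0 m.+1) // (@tcat_tcons _ _ _ m.+1).
Qed.

Lemma nabla_sum n (I : finType) (F : I -> T n) :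
  del n (\sum_i F i) = \sum_i del n (F i).
Proof.
apply: (big_morph (del n)); first exact: nabla_D.
exact: additive0 (@nabla_D _ _ _ _ n).
Qed.

Lemma pow_cast_nabla_pow i i' j j' n (e : (i + j = n)%N) (e' : (i' + j' = n)%N) a b :
  i = i' -> j = j' ->
  pow_cast e (tcat (nabla_pow nabla i a) (nabla_pow nabla j b)) =
  pow_cast e' (tcat (nabla_pow nabla i' a) (nabla_pow nabla j' b)).
Proof. by move=> ii' jj'; subst i' j'; rewrite (eq_irrelevance e e'). Qed.

(** * The braid relation *)

Hypothesis Hcompat : leibniz_compatible nabla.

(** Compatibility is evaluated on s and on s a: by the Leibniz rule nabla_2 (s a)
    is (nabla_2 s) a + s_1 s_2 (s (x) da), and the terms without da cancel. *)
Lemma braid_rel_tcat_dif0 (s : T 2) a (u := tcat s (dif0 Om a : T 1) : T 3) :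
  braid sigma 1 3 (braid sigma 2 3 (braid sigma 1 3 u)) =
  braid sigma 2 3 (braid sigma 1 3 (braid sigma 2 3 u)).
Proof.
have L (v : T 2) : del 2 (@tcat _ _ _ 2 0 v a) = @tcat _ _ _ 3 0 (del 2 v) a
    + braid sigma 1 3 (braid sigma 2 3 (@tcat _ _ _ 2 1 v (dif0 Om a))).
  exact: (@nabla_tcat 2 0 2 erefl erefl erefl v a).
have := Hcompat (@tcat _ _ _ 2 0 s a).
rewrite (@braid_tcat _ _ _ sigma 0 1 0) // !L (@braidD _ _ _ sigma 2) Hcompat.
rewrite (@braid_tcat _ _ _ sigma 1 2 0) // => /addrI.
by rewrite -(@braid_tcat _ _ _ sigma 0 1 1).
Qed.

(** Only the third factor has to be brought to the form (da) b; the coefficient b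
    then moves to the right across the tensor sign, where s_1 and s_2 do not
    act. *)
Lemma braid_rel n (t : T n.+3) :
  braid sigma 1 n.+3 (braid sigma 2 n.+3 (braid sigma 1 n.+3 t)) =
  braid sigma 2 n.+3 (braid sigma 1 n.+3 (braid sigma 2 n.+3 t)).
Proof.
move: t; apply: tpow_additive_eq => [s s'|s s'|x]; try by rewrite !braidD.
apply: tpow_additive_eq => [s s'|s s'|y]; try by rewrite tconsDr !braidD.
apply: tpow_additive_eq => [s s'|s s'|z t]; try by rewrite !tconsDr !braidD.
move: z; apply: one_forms_additive_eq => [v w|v w|a b].
- by rewrite tconsDl !tconsDr !braidD.
- by rewrite tconsDl !tconsDr !braidD.
pose u : T 3 := tcat (tcons x (y : T 1) : T 2) (dif0 Om a : T 1).
have -> : tcons x (tcons y (tcons (dif0 Om a <* b) t)) = tcat u (b *> t).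
  rewrite (@tcat_tcat2 _ _ _ 1 n) tcat1l (@tcat_tcons _ _ _ 1) tcat1l.
  by have [_ _ ->] := tcons_balanced (one_forms Om) n.
by rewrite !(@braid_tcat _ _ _ sigma 0 2) // !(@braid_tcat _ _ _ sigma 1 2) //
  !(@braid_tcat _ _ _ sigma 0 2) // !(@braid_tcat _ _ _ sigma 1 2) // braid_rel_tcat_dif0.
Qed.

(** * Maps intertwined by the connection *)

(** Additivity and left linearity are bundled in because [tid phi] is
    meaningful only for such phi. *)
Record intertwines n (phi : T n -> T n) : Prop := Intertwines {
  itwD : forall s t, phi (s + t) = phi s + phi t;
  itwA : forall a t, phi (a *> t) = a *> phi t;
  itwN : forall t, del n (phi t) = tid phi (del n t) }.

Lemma intertwines_id n : intertwines (@id (T n)).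
Proof.
split=> // t.
by move: (del n t); apply: tpow_additive_eq => [s u|s u|x u]; rewrite ?tidD ?tid_tcons.
Qed.

Lemma intertwines_comp n (f g : T n -> T n) :
  intertwines f -> intertwines g -> intertwines (f \o g).
Proof.
case=> [fD fA fN] [gD gA gN].
by split=> *; rewrite ?tid_comp //= ?gD ?fD ?gA ?fA ?fN ?gN.
Qed.

Lemma intertwines_add n (f g : T n -> T n) :
  intertwines f -> intertwines g -> intertwines (fun t => f t + g t).
Proof.
case=> [fD fA fN] [gD gA gN].
have hD s t : f (s + t) + g (s + t) = (f s + g s) + (f t + g t).
  by rewrite fD gD addrACA.
have hA a t : f (a *> t) + g (a *> t) = a *> (f t + g t).
  by rewrite fA gA lactDr.
split=> // t; rewrite nabla_D fN gN; move: (del n t).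
apply: tpow_additive_eq => [s u|s u|x u].
- by rewrite !tidD // addrACA.
- by rewrite tidD.
by rewrite !tid_tcons // tconsDr.
Qed.

(** On x (x) t the term nabla x (x) phi t is harmless, and in the other one
    id^2 (x) phi commutes with s_1. *)
Lemma intertwines_tid n (f : T n -> T n) : intertwines f -> intertwines (tid f).
Proof.
case=> [fD fA fN]; have hD := tidD fD fA; have hA := tid_lact fD fA.
split=> //; apply: tpow_additive_eq => [s u|s u|x t].
- by rewrite hD nabla_D.
- by rewrite nabla_D tidD.
rewrite tid_tcons // !nabla_tcons fN tidD //; congr (_ + _).
  by rewrite tid_tid_tcat.
by rewrite -braid_tid_tid // tid_tcons.
Qed.

(** On s (x) t with s of degree 2, the term with nabla s is handled by
    compatibility, the one with nabla t by the braid relation. *)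
Lemma intertwines_braid1 n : intertwines (braid sigma 1 n.+2).
Proof.
have bD := @braidD _ _ _ sigma; have bA := @braid_lact _ _ _ sigma.
split=> //; have tidE t : tid (braid sigma 1 n.+2) t = braid sigma 2 n.+3 t by [].
apply: tpow_additive_eq => [s u|s u|x]; try by rewrite ?tidE !(bD, nabla_D).
apply: tpow_additive_eq => [s u|s u|y t];
  try by rewrite tconsDr ?tidE !(bD, nabla_D).
have -> : tcons x (tcons y t) = tcat (tcons x (y : T 1) : T 2) t.
  by rewrite (@tcat_tcons _ _ _ 1) tcat1l.
have L s : del n.+2 (@tcat _ _ _ 2 n s t) = @tcat _ _ _ 3 n (del 2 s) t
    + braid sigma 1 n.+3 (braid sigma 2 n.+3 (@tcat _ _ _ 2 n.+1 s (del n t))).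
  by have := @nabla_tcat 2 n n.+2 erefl erefl erefl s t.
rewrite (@braid_tcat _ _ _ sigma 0 1) // !L tidE bD Hcompat.
rewrite -(@braid_tcat _ _ _ sigma 1 2) // -(@braid_tcat _ _ _ sigma 0 1 n.+1) //.
by rewrite braid_rel.
Qed.

Lemma intertwines_braid i n : intertwines (braid sigma i n).
Proof.
elim: i n => [|i IH] n; first exact: intertwines_id.
case: n => [|n]; first by case: i {IH} => *; exact: intertwines_id.
have := intertwines_tid (IH n).
by case: i n {IH} => [|i] [|n] // _; exact: intertwines_braid1.
Qed.

Lemma intertwines_braids m n : intertwines (braids sigma m n).
Proof.
rewrite /braids; elim: (iota 1 m) => [|i l IH] /=; first exact: intertwines_id.
exact: intertwines_comp (intertwines_braid i n) IH.
Qed.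

Lemma intertwines_binom n j : intertwines (braid_binom sigma n j).
Proof.
elim: n j => [|n IH] j /=; first exact: intertwines_id.
case: (0 < j < n.+1)%N; last exact: intertwines_id.
apply: intertwines_add; last exact: intertwines_tid.
exact: intertwines_comp (intertwines_tid (IH _)) (intertwines_braids _ _).
Qed.

Lemma nabla_binom_tcat i j n (e : (i + j = n)%N) (e1 : (i.+1 + j = n.+1)%N)
    (e2 : (i + j.+1 = n.+1)%N) (s : T i) (t : T j) :
  del n (braid_binom sigma n j (pow_cast e (tcat s t))) =
    tid (braid_binom sigma n j) (pow_cast e1 (tcat (del i s) t))
      + tid (braid_binom sigma n j)
          (braids sigma i n.+1 (pow_cast e2 (tcat s (del j t)))).
Proof.
by case: (intertwines_binom n j) => bD bA ->; rewrite (nabla_tcat e e1 e2) tidD.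
Qed.

End Connection.

(** * The higher order Leibniz rule *)

Theorem lemma4p7 (k : fieldType) (A : algType k) (Om : dga A)
    (nabla : bimod_conn Om) (Hcompat : leibniz_compatible nabla)
    (n : nat) (a b : A) :
  nabla_pow nabla n (a * b) =
    \sum_(j < n.+1)
      braid_binom (conn_braid nabla) n j
        (pow_cast (subnK (leq_ord j))
           (tcat (nabla_pow nabla (n - j) a) (nabla_pow nabla j b))).
Proof.
pose binom m j := braid_binom (conn_braid nabla) m j.
elim: n => [|n IH]; first by rewrite big_ord1 (@pow_cast_id _ _ _ 0).
have e1 (j : 'I_n.+1) : ((n - j).+1 + j = n.+1)%N by rewrite addSn subnK ?leq_ord.
have e2 (j : 'I_n.+1) : (n - j + j.+1 = n.+1)%N by rewrite addnS subnK ?leq_ord.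
have step (j : 'I_n.+1) :=
  nabla_binom_tcat Hcompat (subnK (leq_ord j)) (e1 j) (e2 j)
    (nabla_pow nabla (n - j) a) (nabla_pow nabla j b).
rewrite -[LHS]/(@nabla_ _ _ _ nabla n (nabla_pow nabla n (a * b))) IH nabla_sum.
rewrite (eq_bigr _ (fun j _ => step j)); apply: sum_pascal => [||i].
- rewrite (tid_id (@braid_binom0 _ _ _ _ n)) [RHS]braid_binom0.
  by apply: (@pow_cast_nabla_pow _ _ _ _ _.+1); rewrite ?subn0.
- (* For j = n the block of a has degree 0: there is nothing to braid past. *)
  have braids0 t : braids (conn_braid nabla) (n - @ord_max n) n.+1 t = t.
    by rewrite subnn.
  rewrite (tid_id (@braid_binomn _ _ _ _ n)) braids0 [RHS]braid_binomn.
  by apply: (@pow_cast_nabla_pow _ _ _ _ _ _ _.+1); rewrite ?subnn.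
rewrite [RHS](@braid_binomS _ _ _ _ n i) //; congr (_ + _).
  apply: (congr1 (fun t => tid (binom n i) (braids _ (n - i) n.+1 t))).
  exact: (@pow_cast_nabla_pow _ _ _ _ _ _ _.+1).
apply: (congr1 (tid (binom n i.+1))).
by apply: (@pow_cast_nabla_pow _ _ _ _ _.+1); rewrite ?subnSK.
Qed.
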